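(* Let $0<q<1$, let $a,b$ be real with $0<a<q^{-1}$ and $b<q^{-1}$, and let $v\in\mathbb{C}$. Define $$K=\begin{pmatrix}0&v(1-q)(q^{-1}-a)\\0&0\end{pmatrix},\quad M=\begin{pmatrix}1&v\\0&0\end{pmatrix},\quad A=e^{\log(q)M}=\begin{pmatrix}q&-v(1-q)\\0&1\end{pmatrix}.$$ The $q$-difference operator $(DP)(z)=P(q^{-1}z)F_{-1}(z)+P(z)F_0(z)+P(qz)F_1(z)$ with $$F_{-1}(z)=(z^{-1}-1)A^{-1},\quad F_0(z)=K-z^{-1}(A^{-1}+aA),\quad F_1(z)=(az^{-1}-abq)A,$$ is symmetric with respect to the matrix-valued inner product $\langle\cdot,\cdot\rangle_W$ with weight matrix $$W(q^x)=a^x\frac{(bq;q)_x}{(q;q)_x}A^x(A^* )^x,\quad x\in\mathbb{N}.$$ Moreover, the monic orthogonal polynomials $(P_n)_{n\ge0}$ with respect to $W$ satisfy $DP_n=\Lambda_nP_n$ with eigenvalues $$\Lambda_n=\begin{pmatrix}-q^{-n-1}-abq^{n+2}&v(1-q)(abq^{n+1}-q^{-1-n}+q^{-1}-a)\\0&-q^{-n}-abq^{n+1}\end{pmatrix}.$$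
   Context: $\mathbb{N}=\{0,1,2,\dots\}$; $(c;q)_x=\prod_{i=0}^{x-1}(1-cq^i)$. $\mathbb{P}[z]$ is the space of polynomials in $z$ with coefficients in $\mathrm{Mat}_2(\mathbb{C})$. The inner product is $\langle P,Q\rangle_W=\sum_{x=0}^\infty q^xP(q^x)W(q^x)Q(q^x)^*$. The operator $D$ acts on $\mathbb{P}[z]$, and symmetric means $D\colon\mathbb{P}[z]\to\mathbb{P}[z]$ and $\langle DP,Q\rangle_W=\langle P,DQ\rangle_W$ for all $P,Q\in\mathbb{P}[z]$. The monic orthogonal polynomials $(P_n)_{n\ge0}$ with respect to $W$ are the unique sequence in $\mathbb{P}[z]$ with $P_n$ of degree $n$ with leading coefficient $I$ and $\langle P_m,P_n\rangle_W=0$ for $m\ne n$ (then $\langle P_n,P_n\rangle_W$ is positive definite). *)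

(* Defs.v *)
From HB Require Import structures.
From mathcomp Require Import all_boot all_order all_algebra.
From mathcomp Require Import spectral.
From mathcomp Require Import complex.
From mathcomp Require Import all_classical all_reals all_analysis.

Set Implicit Arguments.
Unset Strict Implicit.
Unset Printing Implicit Defensive.

Import Order.TTheory GRing.Theory Num.Theory.
Import numFieldNormedType.Exports.

Local Open Scope ring_scope.
Local Open Scope complex_scope.
Local Open Scope sesquilinear_scope.
Local Open Scope classical_set_scope.

(* Typed as a numClosedFieldType so that C, and hence 'M[C]_2, inherits the norm
   topology, which is not inferred for R[i] itself. *)
Definition Cplx (R : realType) : numClosedFieldType := R[i].

Definition toC (R : realType) (x : R) : Cplx R := x%:C.

HB.instance Definition _ (R : realType) :=
  GRing.isZmodMorphism.Build R (Cplx R) (@toC R)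
    (raddfB (GRing.RMorphism.clone _ _ (real_complex R) _)).
HB.instance Definition _ (R : realType) :=
  GRing.isMonoidMorphism.Build R (Cplx R) (@toC R)
    (rmorph1 (real_complex R), rmorphM (real_complex R)).

Definition mx2 (T : Type) (x00 x01 x10 x11 : T) : 'M[T]_2 :=
  \matrix_(i, j) (if i == 0 then if j == 0 then x00 else x01
                  else if j == 0 then x10 else x11).

Definition mxexp (R : realType) (X : 'M[Cplx R]_2) : 'M[Cplx R]_2 :=
  limn (series (fun k : nat => (k`!%:R)^-1 *: X ^+ k)).

Definition qPochhammer (R : realType) (c q : R) (x : nat) : R :=
  \prod_(i < x) (1 - c * q ^+ i).

(* Scalar matrices are central, so the value at z of a polynomial with matrix
   coefficients is its value at the scalar matrix z%:M. *)
Definition mpeval (R : realType) (P : {poly 'M[Cplx R]_2}) (z : Cplx R) :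
  'M[Cplx R]_2 := P.[z%:M].

(* W x stands for the value of the weight at q ^ x. *)
Definition mip (R : realType) (q : R) (W : nat -> 'M[Cplx R]_2)
    (P Q : {poly 'M[Cplx R]_2}) : 'M[Cplx R]_2 :=
  limn (series (fun x : nat => toC (q ^+ x) *:
    (mpeval P (toC (q ^+ x)) * W x * (mpeval Q (toC (q ^+ x)))^t*))).

(* The coefficients may have a pole at 0, so a map on polynomials is compared
   with the q-difference expression away from 0; at most one map satisfies
   this, since a polynomial is determined by its values at z != 0. *)
Definition is_qdiff_operator (R : realType) (q : R)
    (Fm1 F0 F1 : Cplx R -> 'M[Cplx R]_2)
    (D : {poly 'M[Cplx R]_2} -> {poly 'M[Cplx R]_2}) : Prop :=
  forall (P : {poly 'M[Cplx R]_2}) (z : Cplx R), z != 0 ->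
    mpeval (D P) z = mpeval P ((toC q)^-1 * z) * Fm1 z + mpeval P z * F0 z
                     + mpeval P (toC q * z) * F1 z.

Definition msymmetric (R : realType) (q : R) (W : nat -> 'M[Cplx R]_2)
    (D : {poly 'M[Cplx R]_2} -> {poly 'M[Cplx R]_2}) : Prop :=
  forall P Q : {poly 'M[Cplx R]_2}, mip q W (D P) Q = mip q W P (D Q).

Definition is_monic_orthogonal (R : realType) (q : R)
    (W : nat -> 'M[Cplx R]_2) (P : nat -> {poly 'M[Cplx R]_2}) : Prop :=
  (forall n : nat, size (P n) = n.+1 /\ lead_coef (P n) = 1) /\
  (forall m n : nat, m <> n -> mip q W (P m) (P n) = 0).

Section LittleQJacobi.
Variables (R : realType) (q a b : R) (v : Cplx R).

Definition lqJ_K : 'M[Cplx R]_2 :=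
  mx2 0 (v * toC ((1 - q) * (q^-1 - a))) 0 0.

Definition lqJ_M : 'M[Cplx R]_2 := mx2 1 v 0 0.

Definition lqJ_A : 'M[Cplx R]_2 := mxexp (toC (ln q) *: lqJ_M).

Definition lqJ_Fm1 (z : Cplx R) : 'M[Cplx R]_2 := (z^-1 - 1) *: lqJ_A^-1.

Definition lqJ_F0 (z : Cplx R) : 'M[Cplx R]_2 :=
  lqJ_K - z^-1 *: (lqJ_A^-1 + toC a *: lqJ_A).

Definition lqJ_F1 (z : Cplx R) : 'M[Cplx R]_2 :=
  (toC a * z^-1 - toC (a * b * q)) *: lqJ_A.

Definition lqJ_W (x : nat) : 'M[Cplx R]_2 :=
  toC (a ^+ x * (qPochhammer (b * q) q x / qPochhammer q q x)) *:
    (lqJ_A ^+ x * (lqJ_A^t*) ^+ x).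

Definition lqJ_Lambda (n : nat) : 'M[Cplx R]_2 :=
  mx2 (toC (- q ^- n.+1 - a * b * q ^+ n.+2))
      (v * toC ((1 - q) * (a * b * q ^+ n.+1 - q ^- n.+1 + q^-1 - a)))
      0
      (toC (- q ^- n - a * b * q ^+ n.+1)).

End LittleQJacobi.

(* Main.v *)
From HB Require Import structures.
Require Import Defs.
From mathcomp Require Import all_boot all_order all_algebra.
From mathcomp Require Import spectral sesquilinear complex.
From mathcomp Require Import all_classical all_reals all_analysis.
From mathcomp Require Import ring lra.

Import Order.TTheory GRing.Theory Num.Theory.
Import numFieldNormedType.Exports.

Local Open Scope ring_scope.
Local Open Scope classical_set_scope.
Local Open Scope sesquilinear_scope.

(** Why the theorem holds.

    The matrix M is idempotent, so A = exp (ln q M) = q^M with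
    t^M := (1 - M) + t M, a function of t that is multiplicative, polynomial
    in t and still defined at t = 0. Writing J_P(t) := P(t) t^M, the inner
    product becomes that of the scalar weight w(x) = a^x (bq;q)_x / (q;q)_x:
    the x-th term of <P,Q> is q^x w(x) J_P(q^x) J_Q(q^x)^*. The commutation
    rules t^M K = t K and K t^M = K turn D into an operator on the J_P,

      J_{DP}(t) = (1/t - 1) J_P(t/q) + (1/t) J_P(t) S + (a/t - abq) J_P(qt),

    with S = K - A^-1 - a A (lqJ_gauge_D). The off-diagonal entries of S
    cancel, which is what the choice of K is for: S is a real diagonal matrix,
    hence self-adjoint (lqJ_gaugeF0_diag).

    Symmetry is then a summation by parts (series_summation_by_parts). The
    Pearson-type recurrence w(x+1)(1 - q^(x+1)) = a (1 - b q^(x+1)) w(x) makes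
    the terms of <DP,Q> and <P,DQ> coincide up to a telescoping flux; there is
    no boundary term at x = 0 because 1 - q^0 = 0. At infinity the flux need not
    be small by itself, since a may be at least 1, but the difference of the two
    fluxes is a polynomial in t = q^x vanishing at t = 0, times w(x). It thus
    has a factor q^x and is the general term of a convergent series
    (lqJ_flux_cvg0). Convergence everywhere reduces to that of the moment series
    of q^x w(x), which is bounded by a geometric series of ratio aq < 1.

    For the eigenvalue equation (monic_orthogonal_eigen), the pole of the
    coefficients at 0 cancels, so D acts on coefficients, does not raise the
    degree, and multiplies a coefficient of top degree n by Lambda_n on the
    right. For monic P_n the polynomial E = D P_n - Lambda_n P_n therefore has
    degree less than n. By symmetry it is orthogonal to everything of degree
    less than n, in particular to itself, and the inner product is definite
    (lqJ_definite), so E = 0. *)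

(** * Series in groups and in spaces of matrices *)

(** A linear map is a finite combination of the coordinates, which are
    continuous. *)
Lemma linear_mx_continuous (K : numFieldType) (m n p r : nat)
    (f : {linear 'M[K]_(m, n) -> 'M[K]_(p, r)}) :
  continuous f.
Proof.
have E : (f : _ -> _) =
    fun Y => \sum_i \sum_j Y i j *: f (delta_mx i j).
  apply/funext => Y; rewrite {1}[Y]matrix_sum_delta linear_sum.
  apply: eq_bigr => i _; rewrite linear_sum; apply: eq_bigr => j _.
  exact: linearZ.
have csum (I : Type) (s : seq I) (F : I -> 'M[K]_(m, n) -> 'M[K]_(p, r)) :
    (forall i, continuous (F i)) -> continuous (fun Y => \sum_(i <- s) F i Y).
  move=> cF; elim: s => [|i s IHs] Y.
    rewrite (_ : (fun Z => _) = cst 0); first exact: cst_continuous.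
    by apply/funext => Z; rewrite big_nil.
  rewrite (_ : (fun Z => _) = F i + fun Z => \sum_(k <- s) F k Z).
    by apply: continuousD; [exact: cF | exact: IHs].
  by apply/funext => Z; rewrite big_cons.
rewrite E; apply: (csum) => i; apply: (csum) => j Y.
apply: (@cvgZr_tmp _ _ _ (nbhs Y) _ (fun Z => Z i j) _ _ _).
exact: coord_continuous.
Qed.

Lemma cvg_series_linear (K : numFieldType) (m n p r : nat)
    (g : {linear 'M[K]_(m, n) -> 'M[K]_(p, r)})
    (f : nat -> 'M[K]_(m, n)) (l : 'M[K]_(m, n)) :
  series f @ \oo --> l -> series (g \o f) @ \oo --> g l.
Proof.
move=> fl; rewrite (_ : series (g \o f) = g \o series f); last first.
  by apply/funext => N; rewrite /series /= linear_sum.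
apply: cvg_comp fl _; exact: linear_mx_continuous.
Qed.

Lemma nneg_series_cvg0 (K : numFieldType) (t : nat -> K) :
  (forall n, 0 <= t n) -> series t @ \oo --> 0 -> forall n, t n = 0.
Proof.
move=> t_ge0 t0 n; apply/eqP; apply/negPn/negP => tn0.
have tn_gt0 : 0 < t n by rewrite lt_def tn0 t_ge0.
have /cvgrPdist_lt /(_ _ tn_gt0)[N _ HN] := t0.
have := HN (maxn N n.+1) (leq_maxl _ _).
have tail_ge : t n <= series t (maxn N n.+1).
  rewrite /series /= big_mkord (bigD1 (Ordinal (leq_maxr N n.+1))) //=.
  by rewrite lerDl sumr_ge0.
rewrite /= sub0r normrN ger0_norm ?(le_trans (ltW tn_gt0)) //.
by move=> /lt_geF; rewrite tail_ge.
Qed.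

(** The right-hand side is symmetric in X and Y except for the last term, so that
    exchanging X and Y changes the partial sum by Y_N - X_N only. *)
Lemma series_summation_by_parts (V : zmodType)
    (T X Y Z : nat -> V) (N : nat) :
  T 0%N = Z 0%N + Y 0%N -> (forall x, T x.+1 = X x + Z x.+1 + Y x.+1) ->
  series T N.+1 = series (X \+ Y) N + series Z N.+1 + Y N.
Proof.
move=> T0 TS; elim: N => [|N IHN].
  by rewrite /series /= !big_nat1 big_geq // add0r.
have serS (U : nat -> V) k : series U k.+1 = series U k + U k.
  by rewrite /series /= big_nat_recr.
rewrite [LHS]serS IHN TS (serS (X \+ Y)) [series Z N.+2]serS /=.
by rewrite [LHS](AC (3 * 3) (1 * (4 * 3) * (2 * 5) * 6)).
Qed.

(** * Real scalars and adjoints *)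

Section RealScalars.
Context {R : realType}.

Lemma normr_toC (x : R) : `|toC x| = toC `|x|.
Proof.
by rewrite [LHS](normc_def (x%:C)%C) /= expr0n /= addr0 sqrtr_sqr.
Qed.

Lemma ler_toC (x y : R) : (toC x <= toC y) = (x <= y).
Proof. exact: lecR. Qed.

Lemma ltr_toC (x y : R) : (toC x < toC y) = (x < y).
Proof. exact: ltcR. Qed.

Lemma toC_inj : injective (@toC R).
Proof. by move=> x y /(congr1 (@complex.Re R)). Qed.

Lemma conj_toC (x : R) : (toC x)^* = toC x.
Proof.
by apply/CrealP; rewrite realE -[0](raddf0 (@toC R)) !ler_toC le_total.
Qed.

Lemma pos_toC (e : Cplx R) : 0 < e -> exists2 x : R, 0 < x & e = toC x.
Proof.
case: e => x y; rewrite ltcE /= => /andP[/eqP y0 x0].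
by exists x => //; rewrite y0.
Qed.

Lemma cvg_toC (u : nat -> R) (l : R) :
  u @ \oo --> l -> (fun n => toC (u n)) @ \oo --> toC l.
Proof.
move=> /cvgrPdist_lt ul; apply/cvgrPdist_lt => e /pos_toC [x x_gt0 ->].
have := ul x x_gt0; apply: filterS => n.
by rewrite -raddfB normr_toC ltr_toC.
Qed.

(** Every convergence of complex matrices below is reduced to real series
    through this lemma. *)
Lemma cvg_series_toC (u : nat -> R) (V : normedModType (Cplx R)) (c : V) (l : R) :
  series u @ \oo --> l ->
  series (fun n => toC (u n) *: c) @ \oo --> toC l *: c.
Proof.
move=> /cvg_toC ul.
rewrite (_ : series _ = fun n => toC (series u n) *: c).
  exact: cvgZr_tmp.
by apply/funext => N; rewrite /series /= raddf_sum scaler_suml.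
Qed.

Lemma adjM (n : nat) (A B : 'M[Cplx R]_n.+1) : (A * B)^t* = B^t* * A^t*.
Proof. by rewrite -!mulmxE trmx_mul map_mxM. Qed.

Lemma adjD (n : nat) (A B : 'M[Cplx R]_n.+1) : (A + B)^t* = A^t* + B^t*.
Proof. by rewrite !raddfD. Qed.

Lemma adjK (n : nat) (A : 'M[Cplx R]_n.+1) : (A^t*)^t* = A.
Proof. by apply/matrixP => i j; rewrite !mxE conjCK. Qed.

Lemma adjZ (n : nat) (x : R) (A : 'M[Cplx R]_n.+1) :
  (toC x *: A)^t* = toC x *: A^t*.
Proof. by apply/matrixP => i j; rewrite !mxE rmorphM /= conj_toC. Qed.

Lemma adj1 (n : nat) : (1 : 'M[Cplx R]_n.+1)^t* = 1.
Proof. by apply/matrixP => i j; rewrite !mxE eq_sym conjC_nat. Qed.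

Lemma adjX (n : nat) (A : 'M[Cplx R]_n.+1) (k : nat) : (A ^+ k)^t* = A^t* ^+ k.
Proof. by elim: k => [|k IH]; rewrite ?adj1 // exprS exprSr adjM IH. Qed.

(** A diagonal entry of N N^* is the sum of the squared moduli of a row. *)
Lemma adj_eq0 (n : nat) (N : 'M[Cplx R]_n.+1) :
  (forall i, (N * N^t*) i i = 0) -> N = 0.
Proof.
move=> N0; apply/matrixP => i j; rewrite mxE.
have /eqP := N0 i; rewrite mxE psumr_eq0 => [/allP/(_ j)|k _].
  rewrite mem_index_enum !mxE => /(_ isT) /eqP /eqP.
  by rewrite mulf_eq0 conjC_eq0 orbb => /eqP.
by rewrite !mxE mul_conjC_ge0.
Qed.

Lemma adj_ge0 (n : nat) (N : 'M[Cplx R]_n.+1) i : 0 <= (N * N^t*) i i.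
Proof. by rewrite mxE sumr_ge0 // => k _; rewrite !mxE mul_conjC_ge0. Qed.

End RealScalars.

(** * Matrix polynomials as functions of a real variable *)

Section MatrixPolynomialFunctions.
Context {R : realType}.
Local Notation M2 := 'M[Cplx R]_2.

Lemma scalar_mx_mulr (z : Cplx R) (A : M2) : A * z%:M = z *: A.
Proof. by rewrite -mulmxE mul_mx_scalar. Qed.

Lemma scalar_mx_mull (z : Cplx R) (A : M2) : z%:M * A = z *: A.
Proof. by rewrite -mulmxE mul_scalar_mx. Qed.

Lemma mpeval_MXaddC (p : {poly M2}) (c : M2) (z : Cplx R) :
  mpeval (p * 'X + c%:P) z = z *: mpeval p z + c.
Proof. by rewrite /mpeval hornerMXaddC scalar_mx_mulr. Qed.

Lemma mpevalB (p r : {poly M2}) (z : Cplx R) :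
  mpeval (p - r) z = mpeval p z - mpeval r z.
Proof. by rewrite /mpeval hornerD hornerN. Qed.

Lemma mpeval_mulC (c : M2) (p : {poly M2}) (z : Cplx R) :
  mpeval (c%:P * p) z = c * mpeval p z.
Proof. exact: hornerCM. Qed.

Lemma mpeval_coef (n : nat) (p : {poly M2}) (z : Cplx R) :
  (size p <= n)%N -> mpeval p z = \sum_(i < n) z ^+ i *: p`_i.
Proof.
move=> pn; rewrite /mpeval (horner_coef_wide _ pn); apply: eq_bigr => i _.
by rewrite -rmorphXn scalar_mx_mulr.
Qed.

(** Polynomiality is asked of the values on real points: adjoints and dilations
    are then pointwise operations on functions, whereas on polynomials with
    noncommuting coefficients they would have to be defined separately. *)
Definition polyfun (g : R -> M2) : Prop :=
  exists G : {poly M2}, forall t, g t = mpeval G (toC t).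

Lemma polyfun_mpeval (P : {poly M2}) : polyfun (fun t => mpeval P (toC t)).
Proof. by exists P. Qed.

Lemma polyfun_cst (c : M2) : polyfun (fun=> c).
Proof. by exists c%:P => t; rewrite /mpeval hornerC. Qed.

Lemma polyfunD (f g : R -> M2) :
  polyfun f -> polyfun g -> polyfun (fun t => f t + g t).
Proof.
move=> [F fE] [G gE]; exists (F + G) => t.
by rewrite /mpeval hornerD fE gE.
Qed.

Lemma polyfunM (f g : R -> M2) :
  polyfun f -> polyfun g -> polyfun (fun t => f t * g t).
Proof.
move=> [F fE] [G gE]; exists (F * G) => t.
rewrite /mpeval hornerM_comm ?fE ?gE //.
by rewrite /comm_poly scalar_mx_mulr scalar_mx_mull.
Qed.

Lemma polyfun_var (c : M2) : polyfun (fun t => toC t *: c).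
Proof.
by exists (c%:P * 'X) => t; rewrite /mpeval hornerCM hornerX scalar_mx_mulr.
Qed.

(** The variable is real, hence fixed by conjugation: only the coefficients are
    replaced by their adjoints. *)
Lemma polyfun_adj (g : R -> M2) : polyfun g -> polyfun (fun t => (g t)^t*).
Proof.
move=> [G gE].
suff [H HE] : polyfun (fun t => (mpeval G (toC t))^t*).
  by exists H => t; rewrite gE.
elim/poly_ind: G {g gE} => [|p c [H HE]].
  exists 0 => t; rewrite /mpeval !horner0.
  by apply/matrixP => i j; rewrite !mxE conjC0.
exists (H * 'X + (c^t*)%:P) => t.
by rewrite !mpeval_MXaddC adjD adjZ HE.
Qed.

Lemma polyfun_dilation (c : R) (g : R -> M2) :
  polyfun g -> polyfun (fun t => g (c * t)).
Proof.
move=> [G gE].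
suff [H HE] : polyfun (fun t => mpeval G (toC (c * t))).
  by exists H => t; rewrite gE.
elim/poly_ind: G {g gE} => [|p d [H HE]].
  by exists 0 => t; rewrite /mpeval !horner0.
exists (((toC c)%:M%:P * H) * 'X + d%:P) => t.
rewrite !mpeval_MXaddC HE mpeval_mulC scalar_mx_mull scalerA.
by rewrite rmorphM [toC c * _]mulrC.
Qed.

Lemma polyfun_factor (g : R -> M2) : polyfun g -> g 0 = 0 ->
  exists2 h : R -> M2, polyfun h & forall t, g t = toC t *: h t.
Proof.
move=> [G gE] g0.
elim/poly_ind: G gE => [|p d _] gE.
  exists (fun=> 0) => [|t]; first exact: polyfun_cst.
  by rewrite gE /mpeval horner0 scaler0.
exists (fun t => mpeval p (toC t)) => [|t]; first exact: polyfun_mpeval.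
move: g0; rewrite !gE !mpeval_MXaddC raddf0 scale0r add0r => ->.
by rewrite addr0.
Qed.

(** Removing the constant term of g and a factor q^x replaces mu by the weight
    mu(x) q^x, which is summable as well: induction on g for all weights. *)
Lemma cvg_series_polyfun (q : R) (mu : nat -> R) (g : R -> M2) :
  0 <= q <= 1 -> (forall x, 0 <= mu x) -> cvgn (series mu) -> polyfun g ->
  cvgn (series (fun x => toC (mu x) *: g (q ^+ x))).
Proof.
move=> /andP[q0 q1] mu0 cmu [G gE]; under eq_fun do rewrite gE; move: G {g gE}.
move=> G; elim/poly_ind: G mu mu0 cmu => [|p c IH] mu mu0 cmu.
  apply/cvg_ex; exists 0; rewrite (_ : series _ = cst 0); first exact: cvg_cst.
  apply/funext => N; rewrite /series /= big1 // => x _.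
  by rewrite /mpeval horner0 scaler0.
rewrite (_ : series _ =
    series (fun x => toC (mu x * q ^+ x) *: mpeval p (toC (q ^+ x))) +
    series (fun x => toC (mu x) *: c)).
  apply: is_cvgD; last by apply/cvg_ex; exists (toC (limn (series mu)) *: c);
    apply: cvg_series_toC.
  apply: IH => [x|]; first by rewrite mulr_ge0 ?exprn_ge0.
  apply: series_le_cvg cmu => [x|//|x]; first by rewrite mulr_ge0 ?exprn_ge0.
  by rewrite ler_piMr // exprn_ile1.
apply/funext => N; rewrite -[RHS]big_split; apply: eq_bigr => x _ /=.
by rewrite mpeval_MXaddC scalerDr scalerA rmorphM.
Qed.

End MatrixPolynomialFunctions.

(** * Orthogonal polynomials of a symmetric operator *)

Section InnerProduct.
Context {R : realType} (q : R) (W : nat -> 'M[Cplx R]_2).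
Local Notation M2 := 'M[Cplx R]_2.

Definition mip_term (P Q : {poly M2}) (x : nat) : M2 :=
  toC (q ^+ x) *:
    (mpeval P (toC (q ^+ x)) * W x * (mpeval Q (toC (q ^+ x)))^t*).

Definition mip_summable : Prop :=
  forall P Q : {poly M2}, cvgn (series (mip_term P Q)).

Lemma mip_lim (P Q : {poly M2}) (l : M2) :
  series (mip_term P Q) @ \oo --> l -> mip q W P Q = l.
Proof. by move=> Pl; apply: cvg_lim => //; exact: norm_hausdorff. Qed.

Lemma cvg_mip (cW : mip_summable) (P Q : {poly M2}) :
  series (mip_term P Q) @ \oo --> mip q W P Q.
Proof. exact: cW. Qed.

Lemma mipBl (cW : mip_summable) (P1 P2 Q : {poly M2}) :
  mip q W (P1 - P2) Q = mip q W P1 Q - mip q W P2 Q.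
Proof.
apply: mip_lim.
rewrite (_ : series _ = series (mip_term P1 Q) - series (mip_term P2 Q)).
  by apply: cvgB; exact: cvg_mip.
apply/funext => N; rewrite -[RHS]sumrB; apply: eq_bigr => x _.
by rewrite /mip_term mpevalB !mulrBl scalerBr.
Qed.

Lemma mipMl (cW : mip_summable) (C : M2) (P Q : {poly M2}) :
  mip q W (C%:P * P) Q = C * mip q W P Q.
Proof.
apply: mip_lim.
have -> : mip_term (C%:P * P) Q = mulmx C \o mip_term P Q.
  apply/funext => x /=; rewrite /mip_term mpeval_mulC -scalemxAr.
  by rewrite mulmxE !mulrA.
exact: (@cvg_series_linear _ _ _ _ _ (mulmx C)) (cvg_mip cW P Q).
Qed.

Lemma mipBr (cW : mip_summable) (P Q1 Q2 : {poly M2}) :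
  mip q W P (Q1 - Q2) = mip q W P Q1 - mip q W P Q2.
Proof.
apply: mip_lim.
rewrite (_ : series _ = series (mip_term P Q1) - series (mip_term P Q2)).
  by apply: cvgB; exact: cvg_mip.
apply/funext => N; rewrite -[RHS]sumrB; apply: eq_bigr => x _.
rewrite /mip_term mpevalB (_ : (_ - _)^t* = (mpeval Q1 (toC (q ^+ x)))^t* -
   (mpeval Q2 (toC (q ^+ x)))^t*) ?mulrBr ?scalerBr //.
by rewrite !raddfB.
Qed.

Lemma mipMr (cW : mip_summable) (C : M2) (P Q : {poly M2}) :
  mip q W P (C%:P * Q) = mip q W P Q * C^t*.
Proof.
apply: mip_lim.
have -> : mip_term P (C%:P * Q) = mulmxr (C^t*) \o mip_term P Q.
  apply/funext => x /=; rewrite /mip_term mpeval_mulC -scalemxAl.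
  by rewrite mulmxE adjM !mulrA.
exact: (@cvg_series_linear _ _ _ _ _ (mulmxr (C^t*))) (cvg_mip cW P Q).
Qed.

(** The monic P_k with k < n span the polynomials of degree less than n under
    left matrix combinations; subtracting Q_k P_k removes the top coefficient
    of Q. *)
Lemma mip_orthogonal_lower (cW : mip_summable) (P : nat -> {poly M2}) :
  is_monic_orthogonal q W P ->
  forall (n : nat) (Q : {poly M2}), (size Q <= n)%N -> mip q W (P n) Q = 0.
Proof.
move=> [Pmonic Porth] n Q.
suff H k : (k <= n)%N ->
    forall Q : {poly M2}, (size Q <= k)%N -> mip q W (P n) Q = 0.
  exact: H.
elim: k => [_ {}Q|k IHk kn {}Q szQ].
  rewrite leqn0 size_poly_eq0 => /eqP ->.
  by have := mipBr cW (P n) 0 0; rewrite !subrr.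
have [szP lcP] := Pmonic k.
have nk : n <> k by move=> E; rewrite E ltnn in kn.
have : mip q W (P n) (Q - (Q`_k)%:P * P k) = 0.
  apply: (IHk (ltnW kn)); apply/leq_sizeP => j.
  rewrite leq_eqVlt coefB coefCM => /predU1P[<-|kj].
    by move: lcP; rewrite lead_coefE szP /= => ->; rewrite mulr1 subrr.
  have Pkj : (P k)`_j = 0 by rewrite nth_default // szP.
  by rewrite Pkj nth_default ?mulr0 ?subrr // (leq_trans szQ).
by rewrite mipBr // mipMr // Porth // mul0r subr0.
Qed.

(** D P_n - L_n P_n has degree less than n since the top coefficients cancel, and
    it is orthogonal to itself by symmetry: moving D to the other side does not
    raise the degree there. *)
Lemma monic_orthogonal_eigen (cW : mip_summable)
    (W_definite : forall P : {poly M2}, mip q W P P = 0 -> P = 0)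
    (D : {poly M2} -> {poly M2}) (L : nat -> M2)
    (D_size : forall (n : nat) (P : {poly M2}),
      (size P <= n)%N -> (size (D P) <= n)%N)
    (D_lead : forall (n : nat) (P : {poly M2}),
      (size P <= n.+1)%N -> (D P)`_n = P`_n * L n)
    (D_sym : msymmetric q W D) (P : nat -> {poly M2}) :
  is_monic_orthogonal q W P -> forall n, D (P n) = (L n)%:P * P n.
Proof.
move=> Pmo n; have [szP lcP] := Pmo.1 n.
have Plow := mip_orthogonal_lower cW _ Pmo n.
set E := D (P n) - (L n)%:P * P n.
have szE : (size E <= n)%N.
  apply/leq_sizeP => j; rewrite leq_eqVlt coefB coefCM => /predU1P[<-|nj].
    rewrite D_lead ?szP //; move: lcP; rewrite lead_coefE szP /= => ->.
    by rewrite mulr1 mul1r subrr.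
  rewrite [in X in _ * X]nth_default ?szP // mulr0 subr0 nth_default //.
  by rewrite (leq_trans (D_size _ _ (leqnn _))) // szP.
apply/eqP; rewrite -subr_eq0; apply/eqP/W_definite; rewrite -/E.
rewrite {1}/E mipBl // mipMl // D_sym !Plow ?mulr0 ?subr0 //.
exact: D_size.
Qed.

End InnerProduct.

(** * Powers with an idempotent exponent *)

(** This is t^M = exp (ln t M) for an idempotent M, extended to all real t,
    in particular to t = 0. *)
HB.lock Definition idem_pow {R : realType} (M : 'M[Cplx R]_2) (t : R) :
  'M[Cplx R]_2 := 1 - M + toC t *: M.

Section IdempotentPowers.
Context {R : realType}.
Local Notation M2 := 'M[Cplx R]_2.

Lemma idem_powE (M : M2) (t : R) : idem_pow M t = 1 - M + toC t *: M.
Proof. by rewrite idem_pow.unlock. Qed.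

Lemma idem_pow1 (M : M2) : idem_pow M 1 = 1.
Proof. by rewrite idem_powE rmorph1 scale1r subrK. Qed.

Lemma idem_powM (M : M2) (s t : R) : M * M == M ->
  idem_pow M s * idem_pow M t = idem_pow M (s * t).
Proof.
move=> /eqP MM; rewrite !idem_powE.
have NM : (1 - M) * M = 0 by rewrite mulrBl mul1r MM subrr.
have MN : M * (1 - M) = 0 by rewrite mulrBr mulr1 MM subrr.
have NN : (1 - M) * (1 - M) = 1 - M by rewrite {1}mulrBl mul1r MN subr0.
move: (1 - M) NM MN NN => N NM MN NN.
rewrite mulrDr !mulrDl -!scalerAr -!scalerAl NN MN NM MM.
by rewrite !scaler0 addr0 add0r scalerA -rmorphM [t * s]mulrC.
Qed.

Lemma idem_powX (M : M2) (t : R) (n : nat) : M * M == M ->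
  idem_pow M t ^+ n = idem_pow M (t ^+ n).
Proof.
move=> MM; elim: n => [|n IHn]; first by rewrite !expr0 idem_pow1.
by rewrite [LHS]exprS IHn idem_powM // -exprS.
Qed.

Lemma idem_powV (M : M2) (t : R) : M * M == M -> t != 0 ->
  (idem_pow M t)^-1 = idem_pow M t^-1.
Proof.
move=> MM t0.
have VV : idem_pow M t * idem_pow M t^-1 == 1.
  by rewrite idem_powM // divff // idem_pow1.
have U : idem_pow M t \is a GRing.unit.
  apply/unitrP; exists (idem_pow M t^-1).
  by rewrite !idem_powM // mulVf // divff // idem_pow1.
by rewrite -[LHS]mulr1 -(eqP VV) mulKr.
Qed.

(** The powers of s M are s^k M for k > 0 and M + (1 - M) for k = 0; both cases
    are s^k M + 0^k (1 - M), so that the exponential series splits into those of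
    s and of 0. *)
Lemma mxexp_idem (M : M2) (s : R) : M * M == M ->
  mxexp (toC s *: M) = idem_pow M (expR s).
Proof.
move=> MM.
have powE k : (toC s *: M) ^+ k =
    toC (s ^+ k) *: M + toC ((0 : R) ^+ k) *: (1 - M).
  elim: k => [|k IHk]; first by rewrite !expr0 rmorph1 !scale1r addrC subrK.
  rewrite exprS IHk mulrDr -!scalerAr -!scalerAl mulrBr (eqP MM) mulr1 subrr.
  rewrite [(0 : R) ^+ k.+1]exprS mul0r rmorph0 scale0r !scaler0 !addr0.
  by rewrite scalerA -rmorphM -exprSr.
apply: cvg_lim; first exact: norm_hausdorff.
rewrite (_ : series _ = series (fun k => toC (exp_coeff s k) *: M) +
    series (fun k => toC (exp_coeff 0 k) *: (1 - M))); last first.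
  apply/funext => N; rewrite -[RHS]big_split; apply: eq_bigr => k _ /=.
  rewrite powE scalerDr !scalerA /exp_coeff /= !rmorphM !fmorphV !rmorph_nat.
  by rewrite ![_^-1 * _]mulrC.
have -> : idem_pow M (expR s) =
    toC (expR s) *: M + toC (expR (0 : R)) *: (1 - M).
  by rewrite idem_powE expR0 rmorph1 scale1r addrC.
apply: cvgD.
  exact: (cvg_series_toC (exp_coeff s) _ M _ (is_cvg_series_exp_coeff s)).
exact: (cvg_series_toC (exp_coeff 0) _ (1 - M) _
  (is_cvg_series_exp_coeff 0)).
Qed.

End IdempotentPowers.

(** * The scalar weight *)

Section Weight.
Context {R : realType}.

Definition lqJ_w (q a b : R) (x : nat) : R :=
  a ^+ x * (qPochhammer (b * q) q x / qPochhammer q q x).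

Lemma qPochhammerS (c q : R) (x : nat) :
  qPochhammer c q x.+1 = qPochhammer c q x * (1 - c * q ^+ x).
Proof. by rewrite /qPochhammer big_ord_recr. Qed.

Lemma qPochhammer_gt0 (c q : R) (x : nat) : 0 < q < 1 -> c < 1 ->
  0 < qPochhammer c q x.
Proof.
move=> /andP[q0 q1] c1; apply: prodr_gt0 => i _; rewrite subr_gt0.
have qi : 0 < q ^+ i <= 1 by rewrite exprn_gt0 // exprn_ile1 // ltW.
by nra.
Qed.

Lemma lqJ_w_gt0 (q a b : R) (x : nat) :
  0 < q < 1 -> 0 < a -> b < q^-1 -> 0 < lqJ_w q a b x.
Proof.
move=> hq a0 hb; have /andP[q0 q1] := hq.
rewrite mulr_gt0 ?exprn_gt0 // divr_gt0 ?qPochhammer_gt0 //.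
by rewrite -ltr_pdivlMr // mul1r.
Qed.

(** The recurrence that matches the coefficient of P(z/q) in D at x + 1 with the
    coefficient of P(qz) at x. *)
Lemma lqJ_wS (q a b : R) (x : nat) : 0 < q < 1 ->
  lqJ_w q a b x.+1 * (1 - q ^+ x.+1) =
  a * (1 - b * q ^+ x.+1) * lqJ_w q a b x.
Proof.
move=> hq; have /andP[q0 q1] := hq.
have h1 : qPochhammer q q x != 0 by rewrite gt_eqF ?qPochhammer_gt0.
have h2 : 1 - q * q ^+ x != 0.
  by rewrite gt_eqF // subr_gt0 -exprS exprn_ilt1 // ltW.
rewrite /lqJ_w !qPochhammerS !exprS; field; by rewrite h1 h2.
Qed.

(** The quotient of two consecutive ratios is
    1 + (1 - b) q^(x+1) / (1 - q^(x+1)) <= 1 + c q^x <= exp (c q^x), with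
    c = |1 - b| q / (1 - q); the exponents sum to a geometric progression. *)
Lemma qPochhammer_ratio_le (q b : R) (x : nat) : 0 < q < 1 -> b < q^-1 ->
  qPochhammer (b * q) q x / qPochhammer q q x <=
  expR (`|1 - b| * q / (1 - q) * ((1 - q ^+ x) / (1 - q))).
Proof.
move=> hq hb; have /andP[q0 q1] := hq.
have bq1 : b * q < 1 by rewrite -ltr_pdivlMr // mul1r.
elim: x => [|x IHx].
  by rewrite /qPochhammer !big_ord0 expr0 subrr mul0r mulr0 expR0 divff.
set c := `|1 - b| * q / (1 - q) in IHx *.
have -> : c * ((1 - q ^+ x.+1) / (1 - q)) =
    c * ((1 - q ^+ x) / (1 - q)) + c * q ^+ x.
  by rewrite exprS; field; rewrite subr_eq0 gt_eqF.
have qx : 0 < q ^+ x <= 1 by rewrite exprn_gt0 // exprn_ile1 // ltW.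
have dx : 0 < 1 - q * q ^+ x by nra.
rewrite expRD !qPochhammerS.
have -> : qPochhammer (b * q) q x * (1 - b * q * q ^+ x) /
    (qPochhammer q q x * (1 - q * q ^+ x)) =
    qPochhammer (b * q) q x / qPochhammer q q x *
    ((1 - b * q * q ^+ x) / (1 - q * q ^+ x)).
  field; by rewrite (gt_eqF dx) gt_eqF // qPochhammer_gt0.
apply: ler_pM IHx _.
- by rewrite divr_ge0 // ltW // qPochhammer_gt0.
- by rewrite divr_ge0 // ltW //; nra.
apply: le_trans (expR_ge1Dx _); rewrite ler_pdivrMr // /c.
have -> : `|1 - b| * q / (1 - q) * q ^+ x = `|1 - b| * (q ^+ x * q / (1 - q)).
  by field; rewrite subr_eq0 gt_eqF.
set d := q ^+ x * q / (1 - q).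
have dd : d * (1 - q) = q ^+ x * q.
  by rewrite /d divfK // subr_eq0 gt_eqF.
have d0 : 0 <= d by rewrite divr_ge0 ?mulr_ge0 ?subr_ge0 ?ltW //; case/andP: qx.
have h : 1 - b <= `|1 - b| by exact: ler_norm.
have h0 : 0 <= `|1 - b| by [].
have h1 : (1 - b) * (q ^+ x * q) <= `|1 - b| * (d * (1 - q * q ^+ x)).
  apply: (@le_trans _ _ (`|1 - b| * (q ^+ x * q))).
    by rewrite ler_wpM2r // mulr_ge0 // ltW //; case/andP: qx.
  by rewrite ler_wpM2l // -dd ler_wpM2l //; nra.
nra.
Qed.

(** The general term is (aq)^x times a bounded ratio, and aq < 1. *)
Lemma lqJ_moment_cvg (q a b : R) : 0 < q < 1 -> 0 < a < q^-1 -> b < q^-1 ->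
  cvgn (series (fun x => q ^+ x * lqJ_w q a b x)).
Proof.
move=> hq /andP[a0 aq] hb; have /andP[q0 q1] := hq.
have aq1 : a * q < 1 by rewrite -ltr_pdivlMr // mul1r.
set B := expR (`|1 - b| * q / (1 - q) * (1 - q)^-1).
have rB x : qPochhammer (b * q) q x / qPochhammer q q x <= B.
  apply: le_trans (qPochhammer_ratio_le _ _ x hq hb) _; rewrite ler_expR.
  have q1' : 0 <= 1 - q by rewrite subr_ge0 ltW.
  apply: ler_wpM2l; first by rewrite divr_ge0 // mulr_ge0 // ltW.
  by rewrite ler_piMl ?invr_ge0 // gerBl exprn_ge0 // ltW.
apply: (@series_le_cvg _ _ (geometric B (a * q))) => [x|x|x|].
- by rewrite mulr_ge0 ?exprn_ge0 ?ltW // lqJ_w_gt0.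
- by rewrite /= mulr_ge0 ?expR_ge0 // exprn_ge0 // mulr_ge0 // ltW.
- rewrite /lqJ_w /= mulrA mulrC [q ^+ x * _]mulrC -exprMn.
  by rewrite ler_wpM2r // exprn_ge0 // mulr_ge0 // ltW.
by apply: is_cvg_geometric_series; rewrite ger0_norm // mulr_ge0 // ltW.
Qed.

End Weight.

(** * Matrices of size two *)

Section MatricesOfSizeTwo.
Variable T : comNzRingType.
Implicit Types x y : T.

Lemma mx2D x00 x01 x10 x11 y00 y01 y10 y11 :
  mx2 x00 x01 x10 x11 + mx2 y00 y01 y10 y11 =
  mx2 (x00 + y00) (x01 + y01) (x10 + y10) (x11 + y11).
Proof.
by apply/matrixP => i j; rewrite !mxE; case: (i == 0); case: (j == 0).
Qed.

Lemma mx2N x00 x01 x10 x11 :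
  - mx2 x00 x01 x10 x11 = mx2 (- x00) (- x01) (- x10) (- x11).
Proof.
by apply/matrixP => i j; rewrite !mxE; case: (i == 0); case: (j == 0).
Qed.

Lemma mx2Z c x00 x01 x10 x11 :
  c *: mx2 x00 x01 x10 x11 = mx2 (c * x00) (c * x01) (c * x10) (c * x11).
Proof.
by apply/matrixP => i j; rewrite !mxE; case: (i == 0); case: (j == 0).
Qed.

Lemma mx2M x00 x01 x10 x11 y00 y01 y10 y11 :
  mx2 x00 x01 x10 x11 * mx2 y00 y01 y10 y11 =
  mx2 (x00 * y00 + x01 * y10) (x00 * y01 + x01 * y11)
      (x10 * y00 + x11 * y10) (x10 * y01 + x11 * y11).
Proof.
apply/matrixP => i j; rewrite !mxE !big_ord_recl big_ord0 !mxE addr0 /=.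
by case: (i == 0); case: (j == 0).
Qed.

Lemma mx2_1 : 1 = mx2 1 0 0 1 :> 'M[T]_2.
Proof.
apply/matrixP => i j; rewrite !mxE.
by case: i => [[|[|i]] //= hi]; case: j => [[|[|j]] //= hj].
Qed.

End MatricesOfSizeTwo.

(** The action of the q-difference operator on the monomial C z^i, with
    zi = z^-1, Z = z^i, u = q^i, ui = q^-i, ca = a, cd = abq, A^-1 written B: a
    coefficient at z^(i-1) and one at z^i. *)
Lemma qdiff_monomial (F : comNzRingType) (C A B K : 'M[F]_2)
    (zi Z ui u ca cd : F) :
  (zi * Z) *: (C * ((ui - 1) *: B + (ca * (u - 1)) *: A)) +
    Z *: (C * (K - ui *: B - (cd * u) *: A)) =
  (ui * Z) *: C * ((zi - 1) *: B) + Z *: C * (K - zi *: (B + ca *: A)) +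
    (u * Z) *: C * ((ca * zi - cd) *: A).
Proof.
rewrite -!scalerAl !scalerAr -!mulrDr; congr (C * _).
by apply/matrixP => i j; rewrite !mxE; ring.
Qed.

Lemma scale_mul_sum3 (F : comNzRingType) (n : nat) (c s1 s2 s3 : F)
    (A B C N : 'M[F]_n.+1) :
  c *: ((s1 *: A + s2 *: B + s3 *: C) * N) =
  (c * s1) *: (A * N) + (c * s2) *: (B * N) + (c * s3) *: (C * N).
Proof. by rewrite !mulrDl -!scalerAl !scalerDr !scalerA. Qed.

(** * The gauged polynomials *)

(** This is the self-adjoint matrix S = K - A^-1 - a A to which F_0 is conjugate:
    F_0(t) t^M = t^-1 t^M S. *)
HB.lock Definition lqJ_gaugeF0 {R : realType} (q a : R) (v : Cplx R) :
  'M[Cplx R]_2 :=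
  lqJ_K q a v - (idem_pow (lqJ_M v) q^-1 + toC a *: idem_pow (lqJ_M v) q).

(** P(t) t^M absorbs the matrix part A^x of the weight, as A^x = (q^x)^M. *)
HB.lock Definition lqJ_gauge {R : realType} (v : Cplx R) (P : {poly 'M[Cplx R]_2})
  (t : R) : 'M[Cplx R]_2 := mpeval P (toC t) * idem_pow (lqJ_M v) t.

(** For (s, t) = (q^(x+1), q^x) this is the part of the x-th term of <DP,Q> coming
    from F_1; for (s, t) = (q^x, q^(x+1)) it is the part of the (x+1)-st term
    coming from F_(-1). *)
HB.lock Definition lqJ_flux {R : realType} (q a b : R) (v : Cplx R)
  (P Q : {poly 'M[Cplx R]_2}) (s t : R) (x : nat) : 'M[Cplx R]_2 :=
  toC (a * (1 - b * q ^+ x.+1) * lqJ_w q a b x) *: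
    (lqJ_gauge v P s * (lqJ_gauge v Q t)^t*).

(** The part of the x-th term of <DP,Q> coming from F_0. *)
HB.lock Definition lqJ_diag {R : realType} (q a b : R) (v : Cplx R)
  (P Q : {poly 'M[Cplx R]_2}) (x : nat) : 'M[Cplx R]_2 :=
  toC (lqJ_w q a b x) *:
    (lqJ_gauge v P (q ^+ x) * lqJ_gaugeF0 q a v * (lqJ_gauge v Q (q ^+ x))^t*).

Section LittleQJacobi.
Context {R : realType} (q a b : R) (v : Cplx R).
Hypotheses (hq : 0 < q < 1) (ha : 0 < a < q^-1) (hb : b < q^-1).
Local Notation M2 := 'M[Cplx R]_2.
Local Notation V := (idem_pow (lqJ_M v)).
Local Notation K := (lqJ_K q a v).
Local Notation W := (lqJ_W q a b v).
Local Notation w := (lqJ_w q a b).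

Let q_gt0 : 0 < q. Proof. by case/andP: hq. Qed.
Let q_neq0 : q != 0. Proof. by rewrite gt_eqF. Qed.

Lemma lqJ_M_idem : lqJ_M v * lqJ_M v == lqJ_M v.
Proof. by rewrite /lqJ_M mx2M !(mulr0, mul0r, mul1r, addr0). Qed.

Lemma lqJ_A_pow : lqJ_A q v = V q.
Proof. by rewrite /lqJ_A mxexp_idem ?lqJ_M_idem // lnK. Qed.

Lemma idem_pow_lqJ (t : R) : V t = mx2 (toC t) (- (v * toC (1 - t))) 0 1.
Proof.
rewrite idem_powE mx2_1 /lqJ_M mx2N mx2Z !mx2D.
rewrite rmorphB rmorph1; congr mx2.
- by rewrite mulr1 subrr add0r.
- by rewrite add0r mulrBr mulr1 opprB addrC [v * _]mulrC.
- by rewrite mulr0 oppr0 !addr0.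
- by rewrite mulr0 oppr0 !addr0.
Qed.

Lemma lqJ_AV : (lqJ_A q v)^-1 = V q^-1.
Proof. by rewrite lqJ_A_pow idem_powV ?lqJ_M_idem. Qed.

Lemma lqJ_KV (t : R) : K * V t = K.
Proof.
rewrite idem_pow_lqJ /lqJ_K mx2M !(mulr0, mul0r, mulr1, addr0, add0r).
by [].
Qed.

Lemma lqJ_VK (t : R) : V t * K = toC t *: K.
Proof.
by rewrite idem_pow_lqJ /lqJ_K mx2M mx2Z !(mulr0, mul0r, mul1r, addr0, add0r).
Qed.

Local Notation S := (lqJ_gaugeF0 q a v).
Local Notation J := (lqJ_gauge v).

Lemma lqJ_gaugeF0E : S = K - (V q^-1 + toC a *: V q).
Proof. by rewrite lqJ_gaugeF0.unlock. Qed.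

Lemma lqJ_gaugeE (P : {poly M2}) (t : R) : J P t = mpeval P (toC t) * V t.
Proof. by rewrite lqJ_gauge.unlock. Qed.

(** The off-diagonal entries v(1-q)(q^-1 - a), - v(1-q) q^-1 and v(1-q) a of K,
    - A^-1 and - a A add up to zero. *)
Lemma lqJ_gaugeF0_diag : S = mx2 (toC (- q^-1 - a * q)) 0 0 (toC (- 1 - a)).
Proof.
rewrite lqJ_gaugeF0E !idem_pow_lqJ /lqJ_K mx2Z mx2D mx2N mx2D; congr mx2.
- by rewrite add0r -rmorphM -rmorphD -rmorphN opprD.
- rewrite mulrN mulrCA -rmorphM opprD !opprK -!mulrDr -!rmorphD.
  rewrite (_ : _ + _ = 0) ?rmorph0 ?mulr0 //.
  by field.
- by rewrite mulr0 addr0 subrr.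
- by rewrite add0r mulr1 opprD rmorphB rmorphN rmorph1.
Qed.

Lemma lqJ_gaugeF0_adj : S^t* = S.
Proof.
rewrite lqJ_gaugeF0_diag; apply/matrixP => i j; rewrite !mxE.
by case: (i == 0); case: (j == 0); rewrite ?conj_toC ?conjC0.
Qed.

Lemma lqJ_Lambda_pow (n : nat) : lqJ_Lambda q a b v n =
  K - toC (q ^- n) *: V q^-1 - toC (a * b * q ^+ n.+1) *: V q.
Proof.
rewrite !idem_pow_lqJ /lqJ_K !mx2Z !mx2N !mx2D; congr mx2.
- rewrite add0r -!rmorphM -!rmorphN -rmorphD; congr toC.
  by rewrite exprSr invfM -exprSr -[_ * q]mulrA -exprSr.
- rewrite !mulrN !opprK !(mulrCA _ v) -!rmorphM -!mulrDr -!rmorphD.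
  congr (v * toC _); rewrite !exprS; field.
  by rewrite q_neq0 expf_neq0.
- by rewrite !mulr0 oppr0 !addr0.
- by rewrite !mulr1 add0r rmorphB rmorphN.
Qed.

Lemma lqJ_W_pow (x : nat) : W x = toC (w x) *: (V (q ^+ x) * (V (q ^+ x))^t*).
Proof. by rewrite /lqJ_W -adjX lqJ_A_pow idem_powX ?lqJ_M_idem. Qed.

Lemma polyfun_gauge (P : {poly M2}) : polyfun (J P).
Proof.
rewrite (_ : J P = fun t => mpeval P (toC t) * V t); last first.
  by apply/funext => t; rewrite lqJ_gaugeE.
apply: polyfunM; first exact: polyfun_mpeval.
rewrite (_ : idem_pow _ = fun t => 1 - lqJ_M v + toC t *: lqJ_M v).
  by apply: polyfunD; [exact: polyfun_cst | exact: polyfun_var].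
by apply/funext => t; rewrite idem_powE.
Qed.

Lemma mip_term_gauge (P Q : {poly M2}) (x : nat) :
  mip_term q W P Q x =
  toC (q ^+ x * w x) *: (J P (q ^+ x) * (J Q (q ^+ x))^t*).
Proof.
rewrite /mip_term lqJ_W_pow !lqJ_gaugeE adjM -scalerAr -scalerAl scalerA -rmorphM.
by rewrite !mulrA.
Qed.

Lemma mip_term_adj (P Q : {poly M2}) (x : nat) :
  (mip_term q W P Q x)^t* = mip_term q W Q P x.
Proof. by rewrite !mip_term_gauge adjZ adjM adjK. Qed.

(** The terms are those of the moment series times a polynomial in q^x. *)
Lemma lqJ_summable : mip_summable q W.
Proof.
move=> P Q; have /andP[q0 q1] := hq; have /andP[a0 _] := ha.
rewrite (_ : mip_term q W P Q = fun x => toC (q ^+ x * w x) *: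
    (fun t => J P t * (J Q t)^t*) (q ^+ x)); last first.
  by apply/funext => x; rewrite mip_term_gauge.
apply: (cvg_series_polyfun q (fun x => q ^+ x * w x)
  (fun t => J P t * (J Q t)^t*)).
- by rewrite !ltW.
- by move=> x; rewrite mulr_ge0 ?exprn_ge0 ?ltW // lqJ_w_gt0.
- exact: lqJ_moment_cvg.
- by apply: polyfunM; [|apply: polyfun_adj]; exact: polyfun_gauge.
Qed.

(** * Definiteness *)

(** The diagonal entries of <P,P> are series of nonnegative terms, so each
    J_P(q^x), and hence each P(q^x), vanishes. The scalar matrices q^x I are
    infinitely many distinct central roots of P. *)
Lemma lqJ_definite (P : {poly M2}) : mip q W P P = 0 -> P = 0.
Proof.
move=> P0.
have JJ0 x i : (J P (q ^+ x) * (J P (q ^+ x))^t*) i i = 0.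
  have mu_gt0 y : 0 < toC (q ^+ y * w y).
    rewrite -[0](raddf0 (@toC R)) ltr_toC mulr_gt0 ?exprn_gt0 //.
    by apply: lqJ_w_gt0 => //; case/andP: ha.
  suff : mip_term q W P P x i i = 0.
    rewrite mip_term_gauge mxE => /eqP; rewrite mulf_eq0 gt_eqF ?mu_gt0 //=.
    by move=> /eqP.
  apply: (nneg_series_cvg0 _ (fun y => mip_term q W P P y i i)) => [y|].
    rewrite mip_term_gauge mxE mulr_ge0 ?adj_ge0 //.
    exact: ltW (mu_gt0 y).
  have cP := cvg_mip _ _ lqJ_summable P P; rewrite P0 in cP.
  have cii : (fun N : M2 => N i i) \o series (mip_term q W P P) @ \oo --> 0.
    rewrite (_ : 0 = (0 : M2) i i :> Cplx R); last by rewrite mxE.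
    by apply: cvg_comp cP _; exact: coord_continuous.
  rewrite (_ : series _ = (fun N : M2 => N i i) \o series (mip_term q W P P)) //.
  by apply/funext => N; rewrite /series /= summxE.
have Px x : mpeval P (toC (q ^+ x)) = 0.
  have J0 : J P (q ^+ x) = 0 by apply: adj_eq0.
  have qx0 : q ^+ x != 0 by rewrite expf_neq0.
  have : J P (q ^+ x) * V (q ^+ x)^-1 = 0 by rewrite J0 mul0r.
  by rewrite !lqJ_gaugeE -mulrA idem_powM ?lqJ_M_idem // divff // idem_pow1 mulr1.
apply/eqP; apply/negPn/negP => nzP.
pose rs := [seq toC (q ^+ x) | x <- iota 0 (size P)].
have rootP : all (root P) [seq z%:M | z <- rs].
  by apply/allP => _ /mapP[_ /mapP[x _ ->] ->]; apply/eqP; exact: Px.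
have uniqP : uniq_roots [seq (z%:M : M2) | z <- rs].
  rewrite (map_uniq_roots scalar_mx) map_inj_uniq ?iota_uniq // => x y /toC_inj.
  have /andP[_ q1] := hq.
  by apply: ieexprIn; rewrite // lt_eqF.
have := max_ring_poly_roots nzP rootP uniqP.
by rewrite !size_map size_iota ltnn.
Qed.

(** * The operator on coefficients *)

(** The coefficient of z^(n-1) in D z^n; it is zero for n = 0, which is the
    cancellation of the pole of D at 0. *)
Definition lqJ_lower (n : nat) : M2 :=
  toC (q ^- n - 1) *: V q^-1 + toC (a * (q ^+ n - 1)) *: V q.

Definition lqJ_D (P : {poly M2}) : {poly M2} :=
  \poly_(i < size P)
    (P`_i.+1 * lqJ_lower i.+1 + P`_i * lqJ_Lambda q a b v i).

Lemma lqJ_D_size (n : nat) (P : {poly M2}) :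
  (size P <= n)%N -> (size (lqJ_D P) <= n)%N.
Proof. by apply: leq_trans; exact: size_poly. Qed.

Lemma lqJ_D_lead (n : nat) (P : {poly M2}) :
  (size P <= n.+1)%N -> (lqJ_D P)`_n = P`_n * lqJ_Lambda q a b v n.
Proof.
move=> szP; rewrite coef_poly (nth_default _ szP) mul0r add0r.
by case: ltnP => // Pn; rewrite nth_default // mul0r.
Qed.

Lemma lqJ_D_qdiff :
  is_qdiff_operator q (lqJ_Fm1 q v) (lqJ_F0 q a v) (lqJ_F1 q a b v) lqJ_D.
Proof.
move=> P z z0; set n := size P.
have DE : mpeval (lqJ_D P) z =
    \sum_(i < n) z ^+ i *: (P`_i.+1 * lqJ_lower i.+1) +
    \sum_(i < n) z ^+ i *: (P`_i * lqJ_Lambda q a b v i).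
  rewrite (mpeval_coef n) ?size_poly // -big_split; apply: eq_bigr => i _ /=.
  by rewrite coef_poly ltn_ord scalerDr.
(* Shift the index: the added term i = 0 vanishes with lqJ_lower 0, the term
   i = n with the coefficient of P. *)
have shift : \sum_(i < n) z ^+ i *: (P`_i.+1 * lqJ_lower i.+1) =
    \sum_(i < n) (z^-1 * z ^+ i) *: (P`_i * lqJ_lower i).
  transitivity (\sum_(i < n.+1) (z^-1 * z ^+ i) *: (P`_i * lqJ_lower i)).
    rewrite big_ord_recl /= /lqJ_lower expr0 invr1 subrr mulr0 !rmorph0.
    rewrite !scale0r addr0 mulr0 scaler0 add0r; apply: eq_bigr => i _.
    by rewrite /bump /= add1n [z ^+ i.+1]exprS mulKf.
  by rewrite big_ord_recr /= [P`_n]nth_default // mul0r scaler0 addr0.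
rewrite [LHS]DE shift {DE shift}.
rewrite (mpeval_coef n P ((toC q)^-1 * z)) // (mpeval_coef n P z) //.
rewrite (mpeval_coef n P (toC q * z)) //.
rewrite 3!mulr_suml -3!big_split; apply: eq_bigr => i _ /=; move: (P`_i) => C.
rewrite lqJ_Lambda_pow /lqJ_lower /lqJ_Fm1 /lqJ_F0 /lqJ_F1 lqJ_AV lqJ_A_pow.
rewrite !exprMn exprVn -(qdiff_monomial _ C).
have -> : toC (q ^- i) = toC q ^- i by rewrite fmorphV rmorphXn.
have -> : toC (q ^- i - 1) = toC q ^- i - 1.
  by rewrite rmorphB rmorph1 fmorphV rmorphXn.
have -> : toC (a * (q ^+ i - 1)) = toC a * (toC q ^+ i - 1).
  by rewrite rmorphM rmorphB rmorph1 rmorphXn.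
have -> : toC (a * b * q ^+ i.+1) = toC (a * b * q) * toC q ^+ i.
  by rewrite exprS mulrA rmorphM rmorphXn.
reflexivity.
Qed.

(** * Symmetry *)

Local Notation flux := (lqJ_flux q a b v).
Local Notation diag := (lqJ_diag q a b v).

Lemma lqJ_fluxE (P Q : {poly M2}) (s t : R) (x : nat) :
  flux P Q s t x =
  toC (a * (1 - b * q ^+ x.+1) * w x) *: (J P s * (J Q t)^t*).
Proof. by rewrite lqJ_flux.unlock. Qed.

Lemma lqJ_diagE (P Q : {poly M2}) (x : nat) :
  diag P Q x = toC (w x) *: (J P (q ^+ x) * S * (J Q (q ^+ x))^t*).
Proof. by rewrite lqJ_diag.unlock. Qed.

(** K t^M = K = t^-1 t^M K and the commutation of powers of A give
    F_0(t) t^M = t^-1 t^M S. *)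
Lemma lqJ_gauge_D (P : {poly M2}) (t : R) : t != 0 ->
  J (lqJ_D P) t = toC (t^-1 - 1) *: J P (q^-1 * t) +
    toC t^-1 *: (J P t * S) +
    toC (a * t^-1 - a * b * q) *: J P (q * t).
Proof.
move=> t0; have tC0 : toC t != 0 by rewrite fmorph_eq0.
rewrite !lqJ_gaugeE lqJ_D_qdiff // /lqJ_Fm1 /lqJ_F0 /lqJ_F1 lqJ_AV lqJ_A_pow.
have -> : (toC q)^-1 * toC t = toC (q^-1 * t) by rewrite rmorphM fmorphV.
have -> : toC q * toC t = toC (q * t) by rewrite rmorphM.
have -> : (toC t)^-1 - 1 = toC (t^-1 - 1) by rewrite rmorphB fmorphV rmorph1.
have -> : toC a * (toC t)^-1 - toC (a * b * q) = toC (a * t^-1 - a * b * q).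
  by rewrite rmorphB; congr (_ - _); rewrite rmorphM fmorphV.
rewrite -fmorphV !mulrDl; congr (_ + _ + _).
- by rewrite -scalerAr -scalerAl -mulrA idem_powM ?lqJ_M_idem.
- have VC : (V q^-1 + toC a *: V q) * V t = V t * (V q^-1 + toC a *: V q).
    rewrite mulrDl mulrDr -scalerAl -scalerAr !(idem_powM _ _ _ lqJ_M_idem).
    by rewrite [t * q]mulrC [t / q]mulrC.
  have tt : toC t^-1 * toC t == 1 by rewrite -rmorphM mulVf // rmorph1.
  rewrite lqJ_gaugeF0E -!mulrA scalerAr; congr (_ * _).
  rewrite mulrBl lqJ_KV -scalerAl VC mulrBr lqJ_VK scalerBr scalerA (eqP tt).
  by rewrite scale1r {VC}.
- by rewrite -scalerAr -scalerAl -[_ * V t]mulrA idem_powM ?lqJ_M_idem.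
Qed.

Lemma mip_term_D (P Q : {poly M2}) (x : nat) :
  mip_term q W (lqJ_D P) Q x =
  toC (w x * (1 - q ^+ x)) *:
     (J P (q^-1 * q ^+ x) * (J Q (q ^+ x))^t*) +
  diag P Q x + flux P Q (q ^+ x.+1) (q ^+ x) x.
Proof.
have qx0 : q ^+ x != 0 by rewrite expf_neq0.
have c1 : q ^+ x * w x * ((q ^+ x)^-1 - 1) = w x * (1 - q ^+ x).
  by rewrite mulrBr mulrBr !mulr1 mulrAC divff // mul1r [w x * _]mulrC.
have c2 : q ^+ x * w x / q ^+ x = w x by rewrite mulrAC divff // mul1r.
have c3 : q ^+ x * w x * (a / q ^+ x - a * b * q) =
    a * (1 - b * q ^+ x.+1) * w x.
  by rewrite exprS; field.
rewrite mip_term_gauge (lqJ_gauge_D P _ qx0) scale_mul_sum3 -!rmorphM.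
by rewrite lqJ_diagE lqJ_fluxE c1 c2 c3 -[q * q ^+ x]exprS.
Qed.

(** The F_(-1) part vanishes at x = 0: this is the boundary condition there. *)
Lemma mip_term_D0 (P Q : {poly M2}) :
  mip_term q W (lqJ_D P) Q 0 =
  diag P Q 0 + flux P Q (q ^+ 1) (q ^+ 0) 0.
Proof. by rewrite mip_term_D expr0 subrr mulr0 rmorph0 scale0r add0r. Qed.

Lemma mip_term_DS (P Q : {poly M2}) (x : nat) :
  mip_term q W (lqJ_D P) Q x.+1 =
  flux P Q (q ^+ x) (q ^+ x.+1) x +
  diag P Q x.+1 + flux P Q (q ^+ x.+2) (q ^+ x.+1) x.+1.
Proof.
have e : q^-1 * q ^+ x.+1 == q ^+ x by rewrite exprS mulKf.
by rewrite mip_term_D (eqP e) (lqJ_wS _ _ _ _ hq) [in RHS]lqJ_fluxE.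
Qed.

Lemma lqJ_flux_adj (P Q : {poly M2}) (s t : R) (x : nat) :
  (flux P Q s t x)^t* = flux Q P t s x.
Proof. by rewrite !lqJ_fluxE adjZ adjM adjK. Qed.

Lemma lqJ_diag_adj (P Q : {poly M2}) (x : nat) :
  (diag P Q x)^t* = diag Q P x.
Proof. by rewrite !lqJ_diagE adjZ !adjM adjK lqJ_gaugeF0_adj mulrA. Qed.

(** Both fluxes have the same value at t = 0 in place of q^x, so their difference
    is a(1 - bqt) w(x) t h(t) with h polynomial: a term of a convergent series. *)
Lemma lqJ_flux_cvg0 (P Q : {poly M2}) :
  (fun x => flux P Q (q ^+ x.+1) (q ^+ x) x -
            flux P Q (q ^+ x) (q ^+ x.+1) x) @ \oo --> (0 : M2).
Proof.
pose g t := J P (q * t) * (J Q t)^t* -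
            J P t * (J Q (q * t))^t*.
have pJ := polyfun_gauge.
have pg : polyfun g.
  rewrite (_ : g = fun t => J P (q * t) * (J Q t)^t* +
     (-1) * (J P t * (J Q (q * t))^t*)).
    apply: polyfunD.
      by apply: polyfunM; [apply: polyfun_dilation|apply: polyfun_adj].
    apply: polyfunM; first exact: polyfun_cst.
    apply: polyfunM => //; apply: polyfun_adj.
    exact: (polyfun_dilation q (J Q)).
  by apply/funext => t; rewrite mulN1r.
have g0 : g 0 = 0 by rewrite /g mulr0 subrr.
have [h ph gh] := polyfun_factor _ pg g0.
pose k t := ((toC a)%:M + toC t *: (- toC (a * b * q))%:M) * h t.
have kE t : k t = toC (a - t * (a * b * q)) *: h t.
  rewrite /k mulrDl -scalerAl !scalar_mx_mull scalerA -scalerDl.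
  by rewrite mulrN -rmorphM -rmorphB.
have pk : polyfun k.
  apply: polyfunM => //; apply: polyfunD; first exact: polyfun_cst.
  exact: polyfun_var.
have /andP[q0 q1] := hq; have /andP[a0 _] := ha.
rewrite (_ : (fun x => _) = fun x => toC (q ^+ x * w x) *: k (q ^+ x)).
  apply: cvg_series_cvg_0.
  apply: (cvg_series_polyfun q (fun x => q ^+ x * w x) k) => //.
  - by rewrite !ltW.
  - by move=> x; rewrite mulr_ge0 ?exprn_ge0 ?ltW // lqJ_w_gt0.
  - exact: lqJ_moment_cvg.
apply/funext => x; rewrite kE scalerA -rmorphM.
rewrite !lqJ_fluxE -scalerBr exprS -/(g (q ^+ x)) gh scalerA -rmorphM.
by congr (toC _ *: _); ring.
Qed.

Lemma lqJ_D_symmetric : msymmetric q W lqJ_D.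
Proof.
move=> P Q.
pose X x := flux P Q (q ^+ x) (q ^+ x.+1) x.
pose Y x := flux P Q (q ^+ x.+1) (q ^+ x) x.
pose T x := mip_term q W (lqJ_D P) Q x.
pose T' x := mip_term q W P (lqJ_D Q) x.
(* T' is the adjoint of the sequence T with P and Q exchanged, which exchanges
   the two fluxes. *)
have E N : series T N.+1 - series T' N.+1 = Y N - X N.
  rewrite [A in A - _](series_summation_by_parts _ T X Y (diag P Q));
    first last.
  - exact: mip_term_DS.
  - exact: mip_term_D0.
  rewrite (series_summation_by_parts _ T' Y X (diag P Q)); first last.
  - move=> x; rewrite /T' -mip_term_adj mip_term_DS !adjD.
    by rewrite !lqJ_flux_adj lqJ_diag_adj.
  - by rewrite /T' -mip_term_adj mip_term_D0 adjD lqJ_flux_adj lqJ_diag_adj.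
  have -> : Y \+ X = X \+ Y by apply/funext => x; rewrite /= addrC.
  by rewrite opprD addrACA subrr add0r.
have cT := cvg_mip _ _ lqJ_summable (lqJ_D P) Q.
have cT' := cvg_mip _ _ lqJ_summable P (lqJ_D Q).
have cl : (fun N => Y N - X N) @ \oo -->
    mip q W (lqJ_D P) Q - mip q W P (lqJ_D Q).
  rewrite (_ : (fun N => _) = fun N => (series T - series T') N.+1).
    rewrite (cvg_shiftS (series T - series T') _).
    have cD := @cvgB _ _ _ \oo _ _ _ _ _ cT cT'.
    exact: cD.
  by apply/funext => N; rewrite -E.
apply/eqP; rewrite -subr_eq0; apply/eqP.
have l1 := cvg_lim (@norm_hausdorff _ _) cl.
have l2 := cvg_lim (@norm_hausdorff _ _) (lqJ_flux_cvg0 P Q).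
by rewrite -l1 -[RHS]l2.
Qed.

End LittleQJacobi.

Theorem theorem5p2 (R : realType) (q a b : R) (v : Cplx R)
    (hq : 0 < q < 1) (ha : 0 < a < q^-1) (hb : b < q^-1) :
  lqJ_A q v = mx2 (toC q) (- (v * toC (1 - q))) 0 1 /\
  exists D : {poly 'M[Cplx R]_2} -> {poly 'M[Cplx R]_2},
    is_qdiff_operator q (lqJ_Fm1 q v) (lqJ_F0 q a v) (lqJ_F1 q a b v) D /\
    msymmetric q (lqJ_W q a b v) D /\
    (forall P : nat -> {poly 'M[Cplx R]_2},
      is_monic_orthogonal q (lqJ_W q a b v) P ->
      forall n : nat, D (P n) = (lqJ_Lambda q a b v n)%:P * P n).
Proof.
split; first by rewrite (lqJ_A_pow q v hq) idem_pow_lqJ.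
exists (lqJ_D q a b v); split; [|split].
- exact: lqJ_D_qdiff.
- exact: lqJ_D_symmetric.
- apply: (monic_orthogonal_eigen q (lqJ_W q a b v)).
  + exact: lqJ_summable.
  + exact: lqJ_definite.
  + exact: lqJ_D_size.
  + exact: lqJ_D_lead.
  + exact: lqJ_D_symmetric.
Qed.
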